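(* Let $\simeq$ be the smallest equivalence relation on the class $\Gamma$ of all rooted graphs such that any two rooted-isomorphic rooted graphs are $\simeq$-equivalent and such that $(G,S)\simeq(G/\sim,[S]_\sim)$ for every $(G,S)\in\Gamma$ and every non-edge-collapsing equivalence relation $\sim$ on $G$. Then for all $(G,S),(H,R)\in\Gamma$, the unfolding trees $\mathcal{T}(G,S)$ and $\mathcal{T}(H,R)$ are rooted-isomorphic if and only if $(G,S)\simeq(H,R)$.
   Context: A graph is $G=(V,E,o,t)$ with vertex set $V$, edge set $E$ and maps $o,t:E\to V$ (origin, terminus); loops and multiple edges allowed. An isomorphism is a pair of bijections on vertices and edges compatible with $o,t$. A walk is an empty walk $\epsilon_v$ ($O=T=v$) or a sequence $e_1\dots e_n$ with $t(e_i)=o(e_{i+1})$, $O=o(e_1)$, $T=t(e_n)$. A root of $G$ is a vertex from which every vertex is reachable by a walk; a rooted graph is $(G,S)$ with $S$ a root. Rooted graphs $(G,S),(H,R)$ are rooted-isomorphic if an isomorphism $G\to H$ maps $S$ to $R$. The unfolding tree $\mathcal{T}(G,S)$ has vertices the walks with origin $S$, an edge from $w$ to $we$ whenever $e$ is an edge and $we$ a walk, and root $\epsilon_S$. An equivalence relation $\sim$ on $G$ is a pair of equivalence relations $\sim_V$ on $V$ and $\sim_E$ on $E$ with $e_1\sim_E e_2\Rightarrow o(e_1)\sim_V o(e_2)$ and $t(e_1)\sim_V t(e_2)$; the quotient $G/\sim$ has vertices $V/\sim_V$, edges $E/\sim_E$, $o([e])=[o(e)]$, $t([e])=[t(e)]$.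 It is non-edge-collapsing if for all $v\sim_V v'$ and every edge $e$ with $o(e)=v$ there is exactly one edge $e'$ with $o(e')=v'$ and $e\sim_E e'$. *)

(* Defs.v *)
From Stdlib Require Import List RelationClasses FinFun.
From Stdlib Require Import FunctionalExtensionality PropExtensionality.
Import ListNotations.

Set Implicit Arguments.

Record graph : Type := Graph {
  vertex : Type;
  edge : Type;
  org : edge -> vertex;
  ter : edge -> vertex
}.

Arguments Graph : clear implicits.
Arguments org {g} _.
Arguments ter {g} _.

(** [is_walk v l]: the edge sequence [l] is a walk with origin [v].  The empty
    sequence, read at [v], is the empty walk at [v]; a nonempty sequence is a
    walk with origin [v] only when [v] is the origin of its first edge. *)
Fixpoint is_walk {G : graph} (v : vertex G) (l : list (edge G)) : Prop :=
  match l with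
  | [] => True
  | e :: l' => org e = v /\ is_walk (ter e) l'
  end.

Fixpoint terminus {G : graph} (v : vertex G) (l : list (edge G)) : vertex G :=
  match l with
  | [] => v
  | e :: l' => terminus (ter e) l'
  end.

Definition is_root (G : graph) (S : vertex G) : Prop :=
  forall v : vertex G, exists l, is_walk S l /\ terminus S l = v.

Record rooted_graph : Type := RootedGraph {
  rgraph :> graph;
  root : vertex rgraph;
  rootP : is_root rgraph root
}.

Arguments RootedGraph : clear implicits.

Definition is_iso (G H : graph)
    (fV : vertex G -> vertex H) (fE : edge G -> edge H) : Prop :=
  Bijective fV /\ Bijective fE /\
  (forall e, org (fE e) = fV (org e)) /\
  (forall e, ter (fE e) = fV (ter e)).

Definition rooted_iso (X Y : rooted_graph) : Prop :=
  exists (fV : vertex X -> vertex Y) (fE : edge X -> edge Y),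
    is_iso X Y fV fE /\ fV (root X) = root Y.

Definition walk_from {G : graph} (S : vertex G) : Type :=
  {l : list (edge G) | is_walk S l}.

Definition empty_walk {G : graph} (S : vertex G) : walk_from S :=
  exist _ [] I.

Lemma is_walk_app (G : graph) (v : vertex G) (l1 l2 : list (edge G)) :
  is_walk v (l1 ++ l2) <-> is_walk v l1 /\ is_walk (terminus v l1) l2.
Proof.
revert v; induction l1 as [|e l1 IH]; intros v; simpl; [tauto|].
rewrite IH; tauto.
Qed.

Lemma terminus_app (G : graph) (v : vertex G) (l1 l2 : list (edge G)) :
  terminus v (l1 ++ l2) = terminus (terminus v l1) l2.
Proof. revert v; induction l1 as [|e l1 IH]; intros v; simpl; auto. Qed.

(** The edge of the tree from [w] to [we] is encoded as the pair [(w, e)]. *)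
Definition tree_edge {G : graph} (S : vertex G) : Type :=
  {p : walk_from S * edge G | is_walk S (proj1_sig (fst p) ++ [snd p])}.

Definition unfolding_graph (G : graph) (S : vertex G) : graph := {|
  vertex := walk_from S;
  edge := tree_edge S;
  org := fun a => fst (proj1_sig a);
  ter := fun a => exist _ (proj1_sig (fst (proj1_sig a)) ++ [snd (proj1_sig a)])
                          (proj2_sig a)
|}.

Lemma unfolding_root (G : graph) (S : vertex G) :
  is_root (unfolding_graph G S) (empty_walk S).
Proof.
intros [l Hl]; induction l as [|e l IH] using rev_ind.
- exists []; split; [exact I|]; simpl; unfold empty_walk; now destruct Hl.
- destruct (proj1 (is_walk_app _ _ _ _) Hl) as [Hl1 _].
  destruct (IH Hl1) as [p [Hp Tp]].
  pose (a := exist _ (exist _ l Hl1, e) Hl : edge (unfolding_graph G S)).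
  exists (p ++ [a]); rewrite is_walk_app, terminus_app, Tp.
  split; [split; [exact Hp|split; [reflexivity|exact I]]|reflexivity].
Qed.

Definition unfolding_tree (X : rooted_graph) : rooted_graph :=
  RootedGraph (unfolding_graph X (root X)) (empty_walk (root X))
    (@unfolding_root X (root X)).

(** [quot R] is the set of equivalence classes of [R], a class being a subset
    of [A]. *)
Definition quot {A : Type} (R : A -> A -> Prop) : Type :=
  {C : A -> Prop | exists a, C = R a}.

Definition class {A : Type} (R : A -> A -> Prop) (a : A) : quot R :=
  exist _ (R a) (ex_intro _ a eq_refl).

Lemma quot_eq {A : Type} (R : A -> A -> Prop) (C D : quot R) :
  proj1_sig C = proj1_sig D -> C = D.
Proof.
destruct C as [C HC], D as [D HD]; simpl; intros ->; f_equal.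
apply proof_irrelevance.
Qed.

Lemma class_surj {A : Type} (R : A -> A -> Prop) (C : quot R) :
  exists a, C = class R a.
Proof. destruct C as [C [a HC]]; exists a; now apply quot_eq. Qed.

Lemma class_eq {A : Type} (R : A -> A -> Prop) (HR : Equivalence R) (a b : A) :
  class R a = class R b <-> R a b.
Proof.
split; intro H.
- change (proj1_sig (class R a) b); rewrite H; simpl; reflexivity.
- apply quot_eq; simpl; extensionality x; apply propositional_extensionality.
  split; intro Hx; [now rewrite <- H|now rewrite H].
Qed.

Lemma quot_map_subproof {A B : Type} (RA : A -> A -> Prop) (RB : B -> B -> Prop)
    (HA : Equivalence RA) (HB : Equivalence RB) (f : A -> B)
    (Hf : forall a a', RA a a' -> RB (f a) (f a')) (C : A -> Prop) :
  (exists a, C = RA a) ->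
  exists b, (fun y => exists a, C a /\ RB (f a) y) = RB b.
Proof.
intros [a ->]; exists (f a).
extensionality y; apply propositional_extensionality; split.
- intros [a' [Ha Hy]]; now rewrite (Hf _ _ Ha).
- intro Hy; exists a; split; [reflexivity|exact Hy].
Qed.

(** The map induced on classes: the image of [C] is the class containing
    [f a] for every [a] in [C]; [quot_map_class] gives its defining equation. *)
Definition quot_map {A B : Type} (RA : A -> A -> Prop) (RB : B -> B -> Prop)
    (HA : Equivalence RA) (HB : Equivalence RB) (f : A -> B)
    (Hf : forall a a', RA a a' -> RB (f a) (f a')) (C : quot RA) : quot RB :=
  exist _ (fun y => exists a, proj1_sig C a /\ RB (f a) y)
    (quot_map_subproof HA HB f Hf (proj2_sig C)).

Lemma quot_map_class {A B : Type} (RA : A -> A -> Prop) (RB : B -> B -> Prop)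
    (HA : Equivalence RA) (HB : Equivalence RB) (f : A -> B)
    (Hf : forall a a', RA a a' -> RB (f a) (f a')) (a : A) :
  quot_map HA HB f Hf (class RA a) = class RB (f a).
Proof.
apply quot_eq; simpl.
extensionality y; apply propositional_extensionality; split.
- intros [a' [Ha Hy]]; now rewrite (Hf _ _ Ha).
- intro Hy; exists a; split; [reflexivity|exact Hy].
Qed.

Record graph_equivalence (G : graph) : Type := GraphEquivalence {
  eqV : vertex G -> vertex G -> Prop;
  eqE : edge G -> edge G -> Prop;
  eqV_equivalence : Equivalence eqV;
  eqE_equivalence : Equivalence eqE;
  eqE_org : forall e1 e2, eqE e1 e2 -> eqV (org e1) (org e2);
  eqE_ter : forall e1 e2, eqE e1 e2 -> eqV (ter e1) (ter e2)
}.

Definition quotient_graph (G : graph) (r : graph_equivalence G) : graph := {|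
  vertex := quot (eqV r);
  edge := quot (eqE r);
  org := quot_map (eqE_equivalence r) (eqV_equivalence r) org (eqE_org r);
  ter := quot_map (eqE_equivalence r) (eqV_equivalence r) ter (eqE_ter r)
|}.

Definition non_edge_collapsing (G : graph) (r : graph_equivalence G) : Prop :=
  forall (v v' : vertex G) (e : edge G), eqV r v v' -> org e = v ->
    exists! e' : edge G, org e' = v' /\ eqE r e e'.

Lemma is_walk_quotient (G : graph) (r : graph_equivalence G) (v : vertex G)
    (l : list (edge G)) :
  is_walk v l ->
  is_walk (class (eqV r) v : vertex (quotient_graph r)) (map (class (eqE r)) l)
  /\ terminus (class (eqV r) v : vertex (quotient_graph r))
       (map (class (eqE r)) l) = class (eqV r) (terminus v l).
Proof.
revert v; induction l as [|e l IH]; intros v; simpl; [now split|].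
intros [<- Hl]; rewrite !quot_map_class.
destruct (IH _ Hl) as [H1 H2]; now repeat split.
Qed.

Lemma quotient_root (G : graph) (r : graph_equivalence G) (S : vertex G) :
  is_root G S -> is_root (quotient_graph r) (class (eqV r) S).
Proof.
intros HS C; destruct (class_surj C) as [v ->].
destruct (HS v) as [l [Hl <-]].
exists (map (class (eqE r)) l); now apply is_walk_quotient.
Qed.

Definition rooted_quotient (X : rooted_graph) (r : graph_equivalence X) :
    rooted_graph :=
  RootedGraph (quotient_graph r) (class (eqV r) (root X))
    (@quotient_root X r (root X) (rootP X)).

Inductive rg_equiv : rooted_graph -> rooted_graph -> Prop :=
| rg_equiv_refl X : rg_equiv X X
| rg_equiv_sym X Y : rg_equiv X Y -> rg_equiv Y X
| rg_equiv_trans X Y Z : rg_equiv X Y -> rg_equiv Y Z -> rg_equiv X Z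
| rg_equiv_iso X Y : rooted_iso X Y -> rg_equiv X Y
| rg_equiv_quotient (X : rooted_graph) (r : graph_equivalence X) :
    non_edge_collapsing r -> rg_equiv X (rooted_quotient X r).

(* Main.v *)
(** A non-edge-collapsing quotient map, an isomorphism and the terminus map of
    an unfolding tree are all coverings: root-preserving morphisms along which
    an edge lifts uniquely once its origin is lifted.  Lifting walks shows that
    a covering induces an isomorphism of unfolding trees.  Conversely, a
    covering is surjective, and its target is the quotient of its source by the
    kernel, which is non-edge-collapsing; so each rooted graph is equivalent to
    its unfolding tree. *)

Require Import Defs.
From Stdlib Require Import List RelationClasses FinFun.
From Stdlib Require Import IndefiniteDescription PropExtensionality.
Import ListNotations.

Set Implicit Arguments.

(** * Bijections and quotients by kernels *)

Lemma injective_surjective_bijective (A B : Type) (f : A -> B) :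
  Injective f -> Surjective f -> Bijective f.
Proof.
intros Hi Hs.
exists (fun b => proj1_sig (constructive_indefinite_description _ (Hs b))).
split.
- intro a; destruct (constructive_indefinite_description _ _) as [a' Ha'].
  now apply Hi.
- intro b; now destruct (constructive_indefinite_description _ _) as [a' Ha'].
Qed.

Lemma sig_inj (A : Type) (P : A -> Prop) (x y : sig P) :
  proj1_sig x = proj1_sig y -> x = y.
Proof.
destruct x as [x Hx], y as [y Hy]; simpl; intros ->; f_equal.
apply proof_irrelevance.
Qed.

(** [g] evaluates [f] at a chosen representative of the class. The choice is harmless because [R] is
    the kernel of [f], which also gives injectivity. *)
Lemma quot_kernel_bijection (A B : Type) (R : A -> A -> Prop) (f : A -> B) :
  Equivalence R -> (forall a b, R a b <-> f a = f b) -> Surjective f ->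
  exists g : quot R -> B, Bijective g /\ forall a, g (class R a) = f a.
Proof.
intros HR Hf Hs.
pose (rep C := constructive_indefinite_description _ (@class_surj A R C)).
exists (fun C => f (proj1_sig (rep C))).
assert (Hg : forall a, f (proj1_sig (rep (class R a))) = f a).
{ intro a; destruct (rep (class R a)) as [b Hb]; simpl.
  symmetry; now apply Hf, class_eq. }
split; [apply injective_surjective_bijective|exact Hg].
- intros C D; destruct (class_surj C) as [a ->], (class_surj D) as [b ->].
  rewrite !Hg; intro H; now apply class_eq, Hf.
- intro b; destruct (Hs b) as [a <-]; now exists (class R a).
Qed.

(** * Rooted isomorphism as an equivalence relation *)

Lemma rooted_iso_sym (X Y : rooted_graph) : rooted_iso X Y -> rooted_iso Y X.
Proof.
intros (fV & fE & ((gV & HV1 & HV2) & (gE & HE1 & HE2) & Ho & Ht) & Hr).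
exists gV, gE; split; [split; [|split; [|split]]|].
- now exists fV.
- now exists fE.
- intro e; now rewrite <- (HV1 (org (gE e))), <- Ho, HE2.
- intro e; now rewrite <- (HV1 (ter (gE e))), <- Ht, HE2.
- now rewrite <- Hr.
Qed.

Lemma bijective_comp (A B C : Type) (f : A -> B) (g : B -> C) :
  Bijective f -> Bijective g -> Bijective (fun x => g (f x)).
Proof.
intros (f' & F1 & F2) (g' & G1 & G2); exists (fun z => f' (g' z)).
split; intro; [now rewrite G1|now rewrite F2].
Qed.

Lemma rooted_iso_trans (X Y Z : rooted_graph) :
  rooted_iso X Y -> rooted_iso Y Z -> rooted_iso X Z.
Proof.
intros (fV & fE & (HV & HE & Ho & Ht) & Hr)
  (gV & gE & (KV & KE & Ko & Kt) & Kr).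
exists (fun v => gV (fV v)), (fun e => gE (fE e)).
split; [split; [|split; [|split]]|].
- now apply bijective_comp.
- now apply bijective_comp.
- intro e; now rewrite Ko, Ho.
- intro e; now rewrite Kt, Ht.
- now rewrite Hr.
Qed.

(** * Coverings and their three sources *)

Record is_covering (X Y : rooted_graph)
    (fV : vertex X -> vertex Y) (fE : edge X -> edge Y) : Prop := IsCovering {
  covering_org : forall e, org (fE e) = fV (org e);
  covering_ter : forall e, ter (fE e) = fV (ter e);
  covering_root : fV (root X) = root Y;
  covering_lift : forall v e, org e = fV v ->
    exists! e', org e' = v /\ fE e' = e
}.

Lemma iso_covering (X Y : rooted_graph)
    (fV : vertex X -> vertex Y) (fE : edge X -> edge Y) :
  is_iso X Y fV fE -> fV (root X) = root Y -> is_covering X Y fV fE.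
Proof.
intros ((gV & HV1 & HV2) & (gE & HE1 & HE2) & Ho & Ht) Hr; split; trivial.
intros v e He; exists (gE e); split; [split|].
- now rewrite <- (HV1 (org (gE e))), <- Ho, HE2, He.
- apply HE2.
- intros e' [_ <-]; apply HE1.
Qed.

(** The lifts of the class of [e] at [v] are the edges with origin [v] equivalent to [e]. Since
    [org e] is equivalent to [v], there is exactly one. *)
Lemma quotient_covering (X : rooted_graph) (r : graph_equivalence X) :
  non_edge_collapsing r ->
  is_covering X (rooted_quotient X r) (class (eqV r)) (class (eqE r)).
Proof.
pose proof (eqV_equivalence r) as EV; pose proof (eqE_equivalence r) as EE.
intro Hr; split; simpl; trivial; try (intro; apply quot_map_class).
intros v C; destruct (class_surj C) as [e ->]; rewrite quot_map_class.
intro He; apply (class_eq EV) in He.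
destruct (Hr _ v e He eq_refl) as (e' & [Ho He'] & Hu).
exists e'; split; [split; [exact Ho|]|].
- apply class_eq; [exact EE|now symmetry].
- intros e'' [Ho' H]; apply Hu; split; [exact Ho'|].
  apply (class_eq EE) in H; now symmetry.
Qed.

(** The only lift of [e] at a walk [w] is the tree edge encoded by [(w, e)]. *)
Lemma unfolding_covering (X : rooted_graph) :
  is_covering (unfolding_tree X) X
    (fun w => terminus (root X) (proj1_sig w)) (fun a => snd (proj1_sig a)).
Proof.
split; simpl.
- intros [[w e] H]; simpl in *.
  now apply is_walk_app in H as [_ [H _]].
- intros [[w e] H]; simpl; now rewrite terminus_app.
- reflexivity.
- intros w e He.
  assert (H : is_walk (root X) (proj1_sig w ++ [e])).
  { apply is_walk_app; simpl; repeat split; trivial; apply (proj2_sig w). }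
  exists (exist _ (w, e) H); split; [now split|].
  intros [[w' e'] H']; simpl; intros [<- <-]; now apply sig_inj.
Qed.

(** * Lifting of walks along a covering *)

Section Covering.

Variables (X Y : rooted_graph).
Variables (fV : vertex X -> vertex Y) (fE : edge X -> edge Y).
Hypothesis Hf : is_covering X Y fV fE.

Lemma covering_walk v l : is_walk v l -> is_walk (fV v) (map fE l).
Proof.
revert v; induction l as [|e l IH]; intro v; simpl; trivial.
intros [<- Hl]; rewrite (covering_org Hf), (covering_ter Hf); auto.
Qed.

Lemma covering_terminus v l : terminus (fV v) (map fE l) = fV (terminus v l).
Proof.
revert v; induction l as [|e l IH]; intro v; simpl; trivial.
now rewrite (covering_ter Hf).
Qed.

Lemma covering_walk_inj v l l' :
  is_walk v l -> is_walk v l' -> map fE l = map fE l' -> l = l'.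
Proof.
revert v l'; induction l as [|e l IH]; intros v [|e' l']; simpl; try easy.
intros [<- Hl] [Ho Hl'] H; injection H as He H.
(* Both edges lift [fE e] at the vertex [org e]. *)
assert (e = e') as <-.
{ destruct (covering_lift Hf (org e) _ (covering_org Hf e)) as (e0 & _ & Hu).
  rewrite <- (Hu e); [|now split].
  now rewrite <- (Hu e'). }
f_equal; now apply (IH (ter e)).
Qed.

(** The walk is lifted edge by edge: the terminus of each lifted edge lies over the origin of the
    next edge of [m]. *)
Lemma covering_walk_lift v m :
  is_walk (fV v) m -> exists l, is_walk v l /\ map fE l = m.
Proof.
revert v; induction m as [|e m IH]; intro v; simpl; [now exists []|].
intros [Ho Hm].
destruct (covering_lift Hf v _ Ho) as (e' & [<- <-] & _).
rewrite (covering_ter Hf) in Hm; destruct (IH _ Hm) as (l & Hl & <-).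
now exists (e' :: l).
Qed.

(** A walk from [root Y] to the given vertex lifts to a walk from [root X], whose terminus is a
    preimage. *)
Lemma covering_vertex_surj : Surjective fV.
Proof.
intro v; destruct (rootP Y v) as (m & Hm & <-).
rewrite <- (covering_root Hf) in *.
destruct (covering_walk_lift _ _ Hm) as (l & _ & <-).
exists (terminus (root X) l); now rewrite covering_terminus.
Qed.

Lemma covering_edge_surj : Surjective fE.
Proof.
intro e; destruct (covering_vertex_surj (org e)) as [v Hv].
destruct (covering_lift Hf v _ (eq_sym Hv)) as (e' & [_ He'] & _).
now exists e'.
Qed.

(** * The target of a covering as a quotient of its source *)

(** Kept transparent, so that both relations unfold to equality of images. *)
Definition covering_kernel : graph_equivalence X.
Proof.
refine (@GraphEquivalence X (fun v v' => fV v = fV v')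
  (fun e e' => fE e = fE e') _ _ _ _).
- split; congruence.
- split; congruence.
- intros e e' H; rewrite <- !(covering_org Hf); congruence.
- intros e e' H; rewrite <- !(covering_ter Hf); congruence.
Defined.

(** The edges at [v'] equivalent to [e] are exactly the lifts of [fE e] at [v']. *)
Lemma covering_kernel_non_edge_collapsing :
  non_edge_collapsing covering_kernel.
Proof.
intros v v' e Hv <-; simpl in *.
rewrite <- (covering_org Hf) in Hv.
destruct (covering_lift Hf v' _ Hv) as (e' & [Ho He] & Hu).
exists e'; split; [now split|].
intros e'' [Ho' He']; now apply Hu.
Qed.

Lemma covering_quotient_iso : rooted_iso (rooted_quotient X covering_kernel) Y.
Proof.
destruct (quot_kernel_bijection (eqV_equivalence covering_kernel)
  (fun _ _ => iff_refl _) covering_vertex_surj) as (gV & HV & EV).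
destruct (quot_kernel_bijection (eqE_equivalence covering_kernel)
  (fun _ _ => iff_refl _) covering_edge_surj) as (gE & HE & EE).
exists gV, gE; split; [split; [|split; [|split]]|]; trivial.
- intro C; destruct (class_surj C) as [e ->]; simpl org.
  rewrite quot_map_class, EV, EE; apply (covering_org Hf).
- intro C; destruct (class_surj C) as [e ->]; simpl ter.
  rewrite quot_map_class, EV, EE; apply (covering_ter Hf).
- simpl root; rewrite EV; apply (covering_root Hf).
Qed.

Lemma covering_rg_equiv : rg_equiv X Y.
Proof.
apply rg_equiv_trans with (rooted_quotient X covering_kernel).
- apply rg_equiv_quotient, covering_kernel_non_edge_collapsing.
- apply rg_equiv_iso, covering_quotient_iso.
Qed.

(** * The map induced on unfolding trees *)

Lemma covering_root_walk l : is_walk (root X) l -> is_walk (root Y) (map fE l).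
Proof. rewrite <- (covering_root Hf); apply covering_walk. Qed.

Definition covering_tree_vertex (w : vertex (unfolding_tree X)) :
    vertex (unfolding_tree Y) :=
  exist _ (map fE (proj1_sig w)) (covering_root_walk _ (proj2_sig w)).

Lemma covering_tree_edge_subproof (a : edge (unfolding_tree X)) :
  is_walk (root Y)
    (proj1_sig (covering_tree_vertex (org a)) ++ [fE (snd (proj1_sig a))]).
Proof.
destruct a as [[w e] H]; simpl in *.
apply covering_root_walk in H; now rewrite map_app in H.
Qed.

(** With this encoding, compatibility with origins holds by computation. *)
Definition covering_tree_edge (a : edge (unfolding_tree X)) :
    edge (unfolding_tree Y) :=
  exist _ (covering_tree_vertex (org a), fE (snd (proj1_sig a)))
    (covering_tree_edge_subproof a).

Lemma covering_tree_vertex_inj : Injective covering_tree_vertex.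
Proof.
intros [l Hl] [l' Hl'] H; apply sig_inj; simpl.
apply (f_equal (@proj1_sig _ _)) in H; simpl in H.
now apply (covering_walk_inj (root X)).
Qed.

Lemma covering_tree_vertex_surj : Surjective covering_tree_vertex.
Proof.
intros [m Hm]; pose proof Hm as Hm'; rewrite <- (covering_root Hf) in Hm'.
destruct (covering_walk_lift _ _ Hm') as (l & Hl & E).
exists (exist _ l Hl); now apply sig_inj.
Qed.

Lemma covering_tree_ter a :
  ter (covering_tree_edge a) = covering_tree_vertex (ter a).
Proof. apply sig_inj; simpl; now rewrite map_app. Qed.

End Covering.

(** A nonempty walk determines its last edge and the walk before it, hence the tree edge that ends
    at it. *)
Lemma unfolding_ter_inj (X : rooted_graph) :
  Injective (@ter (unfolding_tree X)).
Proof.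
intros [[[l Hl] e] H] [[[l' Hl'] e'] H'] E.
apply (f_equal (@proj1_sig _ _)) in E; simpl in E.
apply app_inj_tail in E as [-> ->]; apply sig_inj; simpl; f_equal.
now apply sig_inj.
Qed.

Lemma unfolding_ter_surj (X : rooted_graph) (w : vertex (unfolding_tree X)) :
  proj1_sig w <> [] -> exists a, @ter (unfolding_tree X) a = w.
Proof.
destruct w as [l Hl]; simpl; destruct l as [|e l _] using rev_ind; [easy|].
intros _; destruct (proj1 (is_walk_app _ _ _ _) Hl) as [Hl1 _].
exists (exist _ (exist _ l Hl1, e) Hl); now apply sig_inj.
Qed.

(* An edge of an unfolding tree is determined by its terminus, and every
   nonempty walk is a terminus, so bijectivity on edges follows from
   bijectivity on vertices. *)
Lemma covering_unfolding_iso (X Y : rooted_graph)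
    (fV : vertex X -> vertex Y) (fE : edge X -> edge Y) :
  is_covering X Y fV fE -> rooted_iso (unfolding_tree X) (unfolding_tree Y).
Proof.
intro Hf; exists (covering_tree_vertex Hf), (covering_tree_edge Hf).
split; [split; [|split; [|split]]|].
- apply injective_surjective_bijective.
  + apply covering_tree_vertex_inj.
  + apply covering_tree_vertex_surj.
- apply injective_surjective_bijective.
  + intros a a' H; apply unfolding_ter_inj, (covering_tree_vertex_inj (Hf := Hf)).
    now rewrite <- !covering_tree_ter, H.
  + intro b; destruct (covering_tree_vertex_surj Hf (ter b)) as [w Hw].
    (* The image of [w] is [ter b], which has a last edge, so [w] is nonempty. *)
    destruct (unfolding_ter_surj w) as [a Ha].
    { intro H; apply (f_equal (@proj1_sig _ _)) in Hw; simpl in Hw.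
      rewrite H in Hw; now apply (app_cons_not_nil _ _ _ Hw). }
    exists a; apply unfolding_ter_inj; now rewrite covering_tree_ter, Ha.
- reflexivity.
- apply covering_tree_ter.
- now apply sig_inj.
Qed.

Theorem theorem5 : forall X Y : rooted_graph,
  rooted_iso (unfolding_tree X) (unfolding_tree Y) <-> rg_equiv X Y.
Proof.
intros X Y; split.
- intro H; apply rg_equiv_trans with (unfolding_tree X).
  + apply rg_equiv_sym, (covering_rg_equiv (unfolding_covering X)).
  + apply rg_equiv_trans with (unfolding_tree Y).
    * now apply rg_equiv_iso.
    * apply (covering_rg_equiv (unfolding_covering Y)).
(* Having isomorphic unfolding trees is an equivalence relation, and both generators of [rg_equiv]
   are coverings, so it contains [rg_equiv]. *)
- intro H; induction H as [X|X Y _ IH|X Y Z _ IH1 _ IH2|X Y H|X r H].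
  + exists (fun w => w), (fun a => a).
    repeat split; now exists (fun x => x).
  + now apply rooted_iso_sym.
  + now apply rooted_iso_trans with (unfolding_tree Y).
  + destruct H as (fV & fE & Hf & Hr).
    exact (covering_unfolding_iso (iso_covering X Y Hf Hr)).
  + exact (covering_unfolding_iso (quotient_covering X H)).
Qed.
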